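(* Let $A=(a_{ij})$ be an $N\times N$ matrix with real entries, let $\epsilon,\phi\in\mathbb{R}$, and let $\theta_0=(\theta_1,\dots,\theta_N)\in\mathbb{R}^N$. Suppose that $x_0=e^{\mathbf{i}\theta_0}=(e^{\mathbf{i}\theta_1},\dots,e^{\mathbf{i}\theta_N})^T$ is an eigenvector of $A$ associated with the eigenvalue $\lambda\in\mathbb{C}$. Suppose further that $\lambda e^{-\mathbf{i}\phi}\in\mathbb{R}$ (or equivalently, when $\lambda\neq0$, that $-\phi+\arg(\lambda)$ is an integer multiple of $\pi$). Then $\theta_0$ is an equilibrium point of the phase-lag Kuramoto model $$\frac{d\theta_i}{dt}=\epsilon\sum_{j=1}^N a_{ij}\sin(\theta_j-\theta_i-\phi),\qquad 1\le i\le N.$$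
   Context: Here $\mathbf{i}=\sqrt{-1}$. A point $\theta_0=(\theta_1,\dots,\theta_N)\in\mathbb{R}^N$ is an equilibrium point of a system $\dot\theta=f(\theta)$ if $f(\theta_0)=0$, i.e. if the right-hand sides of all the equations vanish at $\theta_0$. *)

(* Defs.v *)
From HB Require Import structures.
From mathcomp Require Import all_boot all_order all_algebra.
From mathcomp Require Import complex.
From mathcomp Require Import reals trigo.

Set Implicit Arguments.
Unset Strict Implicit.
Unset Printing Implicit Defensive.

Import Order.TTheory GRing.Theory Num.Theory.

Local Open Scope ring_scope.
Local Open Scope complex_scope.

(* e^{it} for real t, through Euler's formula (the library has no complex
   exponential). *)
Definition expi (R : realType) (t : R) : R[i] := cos t +i* sin t.

Definition expi_vec (R : realType) (N : nat) (theta : 'cV[R]_N) : 'cV[R[i]]_N :=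
  \col_i expi (theta i 0).

(* Right (column) eigenvectors; [eigenvalue] and [eigenspace] in mxalgebra
   concern row vectors. *)
Definition is_eigenvector (F : fieldType) (N : nat)
    (A : 'M[F]_N) (lambda : F) (x : 'cV[F]_N) : Prop :=
  x != 0 /\ A *m x = lambda *: x.

(* [alpha] is a value of arg(z), an angle determined modulo 2 pi (z != 0). *)
Definition is_arg (R : realType) (z : R[i]) (alpha : R) : Prop :=
  z = `|z| * expi alpha.

(* Right-hand side of
   d theta_i / dt = eps * sum_j a_ij sin (theta_j - theta_i - phi). *)
Definition kuramoto (R : realType) (N : nat) (A : 'M[R]_N) (eps phi : R)
    (theta : 'cV[R]_N) : 'cV[R]_N :=
  \col_i (eps * \sum_(j < N) A i j * sin (theta j 0 - theta i 0 - phi)).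

(* Equilibrium point of the autonomous system d theta / dt = f theta. *)
Definition is_equilibrium (R : realType) (N : nat)
    (f : 'cV[R]_N -> 'cV[R]_N) (theta0 : 'cV[R]_N) : Prop :=
  f theta0 = 0.

(* Main.v *)
Require Import Defs.
From HB Require Import structures.
From mathcomp Require Import all_boot all_order all_algebra.
From mathcomp Require Import complex.
From mathcomp Require Import reals trigo.

Set Implicit Arguments.
Unset Strict Implicit.
Unset Printing Implicit Defensive.

Import Order.TTheory GRing.Theory Num.Theory.

Local Open Scope ring_scope.
Local Open Scope complex_scope.

(** Since every entry of [expi_vec theta0] has modulus 1, row i of the eigenvector equation can be
    solved for lambda e^(-i phi): it equals the sum over j of a_ij e^(i (theta_j - theta_i - phi)).
    The a_ij are real, so its imaginary part, times eps, is the i-th Kuramoto right-hand side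
    ([kuramoto_eigenvector]). This value is the same in every row and vanishes when lambda e^(-i
    phi) is real. The angle criterion follows from the polar form of lambda ([real_mulr_expi]) and
    the zeros of sine ([sin_eq0]). *)

Lemma sin_natpi (R : realType) (n : nat) : sin (n%:R * pi) = 0 :> R.
Proof.
by rewrite mulr_natl -[_ *+ n]add0r (alternatingn (@sinDpi R)) sin0 mulr0.
Qed.

Lemma sin_intpi (R : realType) (k : int) : sin (k%:~R * pi) = 0 :> R.
Proof.
case: k => n; first exact: sin_natpi.
by rewrite NegzE mulrNz mulNr sinN (sin_natpi _ n.+1) oppr0.
Qed.

(** Reduce t modulo pi to a remainder r in [0, pi). Then sin t = sin r cos (k pi) forces sin r = 0,
    and positivity of sine on (0, pi) leaves only r = 0. *)
Lemma sin_eq0 (R : realType) (t : R) :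
  sin t = 0 <-> exists k : int, t = k%:~R * pi.
Proof.
split=> [sint0|[k ->]]; last exact: sin_intpi.
have pi0 := pi_gt0 R.
pose k := Num.floor (t / pi); exists k; apply/eqP; rewrite -subr_eq0.
have /andP[lo hi] := floor_itv (t / pi).
set r := t - _.
have r_ge0 : 0 <= r by rewrite subr_ge0 -ler_pdivlMr.
have r_lt : r < pi.
  rewrite ltrBlDr addrC -{2}(mul1r pi) -mulrDl -ltr_pdivrMr//.
  by rewrite -[1]/(1%:~R) -intrD.
(* Where sine vanishes, cosine has absolute value 1. *)
have cos_neq0 : cos (k%:~R * pi) != 0 :> R.
  by have /sin0cos1/eqP := sin_intpi R k; apply: contraTneq => ->;
     rewrite normr0 eq_sym oner_eq0.
have sinr0 : sin r = 0.
  move: sint0; rewrite -(subrK (k%:~R * pi) t) -/r sinD sin_intpi mulr0 addr0.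
  by move/eqP; rewrite mulf_eq0 (negPf cos_neq0) orbF => /eqP.
case: (ltgtP r 0) r_ge0 => // r_gt0 _.
by have := @sin_gt0_pi R r; rewrite r_gt0 r_lt sinr0 ltxx => /(_ isT).
Qed.

Lemma expiD (R : realType) (s t : R) : expi (s + t) = expi s * expi t.
Proof.
by rewrite /expi cosD sinD; apply/eqP; rewrite eq_complex /= eqxx addrC eqxx.
Qed.

Lemma complex_realE (R : rcfType) (z : R[i]) : (z \is Num.real) = (complex.Im z == 0).
Proof. by case: z => a b; rewrite complex_real. Qed.

(** The nonzero real factor |lambda| does not affect realness, and what remains is e^(i (alpha -
    phi)). *)
Lemma real_mulr_expi (R : realType) (lambda : R[i]) (alpha phi : R) :
  lambda != 0 -> is_arg lambda alpha ->
  (lambda * expi (- phi) \is Num.real) = (sin (- phi + alpha) == 0).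
Proof.
rewrite -normr_eq0 => norm_neq0 ->; rewrite -mulrA -expiD [alpha + _]addrC.
by rewrite realMr ?normr_real// complex_realE.
Qed.

(* Multiplying row i of A x = lambda x by e^(-i (theta_i + phi)) and taking
   imaginary parts. *)
Lemma kuramoto_eigenvector (R : realType) (N : nat) (A : 'M[R]_N) (eps phi : R)
    (theta : 'cV[R]_N) (lambda : R[i]) (i : 'I_N) :
  map_mx (real_complex R) A *m expi_vec theta = lambda *: expi_vec theta ->
  kuramoto A eps phi theta i 0 = eps * complex.Im (lambda * expi (- phi)).
Proof.
move=> /matrixP/(_ i 0); rewrite !mxE => Ax.
have -> : lambda * expi (- phi) =
    \sum_j (A i j)%:C * expi (theta j 0 - theta i 0 - phi).
  (* Inserting the phase theta_i and its opposite makes the right side of row i appear. *)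
  transitivity (lambda * expi (theta i 0) * expi (- theta i 0 - phi)).
    by rewrite -mulrA -expiD addrA subrr add0r.
  rewrite -Ax mulr_suml; apply: eq_bigr => j _.
  by rewrite !mxE -mulrA -expiD addrA.
(* [Rcomplex R] is [R[i]] seen as a real vector space, on which the imaginary part is additive. *)
rewrite (raddf_sum (@complex.Im R : Rcomplex R -> R)); congr (_ * _).
by apply: eq_bigr => j _; rewrite /= mul0r addr0.
Qed.

Theorem proposition7 (R : realType) (N : nat) (A : 'M[R]_N) (eps phi : R)
    (theta0 : 'cV[R]_N) (lambda : R[i])
    (Hx0 : is_eigenvector (map_mx (real_complex R) A) lambda (expi_vec theta0)) :
  (lambda != 0 -> forall alpha : R, is_arg lambda alpha ->
     (lambda * expi (- phi) \is Num.real
        <-> exists k : int, - phi + alpha = k%:~R * pi)) /\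
  (lambda * expi (- phi) \is Num.real ->
     is_equilibrium (kuramoto A eps phi) theta0).
Proof.
split=> [lambda_neq0 alpha arg_alpha|].
  rewrite (real_mulr_expi _ lambda_neq0 arg_alpha) -sin_eq0.
  by split=> /eqP.
rewrite complex_realE => /eqP Im0; apply/colP => i.
by rewrite (kuramoto_eigenvector eps phi i Hx0.2) Im0 mulr0 mxE.
Qed.
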